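(* Let $\mathcal I$ be a flat ideal of subsets of $\omega$. Then either $\mathcal I$ is countably generated, or there is no topology on $\mathcal I$ with which $(\mathcal I,\subseteq)$ is a basic partial order.
   Context: A submeasure is a map $\varphi\colon\mathcal P(\omega)\to[0,\infty]$ with $\varphi(\emptyset)=0$, $\varphi(a)\le\varphi(b)$ for $a\subseteq b$, and $\varphi(a\cup b)\le\varphi(a)+\varphi(b)$. It is lower semicontinuous (lsc) if $\varphi(a)=\lim_n\varphi(a\cap[0,n])$ for all $a$. $\mathrm{Fin}(\varphi)=\{a\subseteq\omega:\varphi(a)<\infty\}$. An lsc submeasure $\varphi$ is flat if for each $M>0$ there is $N>0$ such that for each finite $a\subseteq\omega$ with $\varphi(a)<N$ there is $j$ such that for all $b\subseteq\omega\setminus j$, $\varphi(b)<M$ implies $\varphi(a\cup b)<N$. An ideal is flat if it equals $\mathrm{Fin}(\varphi)$ for some flat lsc submeasure $\varphi$. An ideal is countably generated if some countable subfamily is cofinal in it under inclusion. A partial order $(P,\le)$ with a separable metrizable topology on $P$ is basic if: any two elements have a least upper bound and the binary least-upper-bound operation is continuous; every bounded (from above) sequence has a convergent subsequence; and every convergent sequence has a bounded subsequence. *)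

(* Defs.v *)
From mathcomp Require Import all_boot all_order all_algebra.
From mathcomp Require Import all_classical all_reals all_analysis.
Set Implicit Arguments.
Unset Strict Implicit.
Unset Printing Implicit Defensive.
Import Order.TTheory GRing.Theory Num.Theory.
Local Open Scope classical_set_scope.
Local Open Scope ring_scope.

Definition submeasure (R : realType) (phi : set nat -> \bar R) : Prop :=
  [/\ forall a, (0 <= phi a)%E,
      phi set0 = 0%E,
      forall a b, a `<=` b -> (phi a <= phi b)%E &
      forall a b, (phi (a `|` b) <= phi a + phi b)%E].

Definition lsc (R : realType) (phi : set nat -> \bar R) : Prop :=
  forall a, phi (a `&` [set k | (k <= n)%N]) @[n --> \oo] --> phi a.

Definition Fin (R : realType) (phi : set nat -> \bar R) : set (set nat) :=
  [set a | (phi a < +oo)%E].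

Definition flat (R : realType) (phi : set nat -> \bar R) : Prop :=
  forall M : R, 0 < M -> exists2 N : R, 0 < N &
    forall a, finite_set a -> (phi a < N%:E)%E ->
      exists j : nat, forall b, b `<=` ~` `I_j ->
        (phi b < M%:E)%E -> (phi (a `|` b) < N%:E)%E.

(* An ideal is required neither to be proper nor to contain the finite sets. *)
Definition ideal (I : set (set nat)) : Prop :=
  [/\ I set0,
      forall a b, a `<=` b -> I b -> I a &
      forall a b, I a -> I b -> I (a `|` b)].

Definition flat_ideal (R : realType) (I : set (set nat)) : Prop :=
  ideal I /\
  exists phi : set nat -> \bar R,
    [/\ submeasure phi, lsc phi, flat phi & I = Fin phi].

Definition countably_generated (I : set (set nat)) : Prop :=
  exists G : set (set nat),
    [/\ G `<=` I, countable G & forall a, I a -> exists2 g, G g & a `<=` g].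

Definition is_metric (R : realType) (T : Type) (d : T -> T -> R) : Prop :=
  [/\ forall x y, 0 <= d x y,
      forall x y, d x y = 0 <-> x = y,
      forall x y, d x y = d y x &
      forall x y z, d x z <= d x y + d y z].

Definition metrizable (R : realType) (T : topologicalType) : Prop :=
  exists2 d : T -> T -> R, is_metric d &
    forall (x : T) (A : set T),
      nbhs x A <-> exists2 e : R, 0 < e & [set y | d x y < e] `<=` A.

Definition separable (T : topologicalType) : Prop :=
  exists2 D : set T, countable D & dense D.

Definition partial_order (T : Type) (le : T -> T -> Prop) : Prop :=
  [/\ forall x, le x x,
      forall x y, le x y -> le y x -> x = y &
      forall x y z, le x y -> le y z -> le x z].

Definition is_join (T : Type) (le : T -> T -> Prop) (x y z : T) : Prop :=
  [/\ le x z, le y z & forall w, le x w -> le y w -> le z w].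

Definition seq_bounded (T : Type) (le : T -> T -> Prop) (u : nat -> T) : Prop :=
  exists b, forall n, le (u n) b.

Definition seq_convergent (T : topologicalType) (u : nat -> T) : Prop :=
  exists l : T, u n @[n --> \oo] --> l.

Definition has_subseq (T : Type) (P : (nat -> T) -> Prop) (u : nat -> T) : Prop :=
  exists2 s : nat -> nat, {homo s : m n / (m < n)%N} & P (u \o s).

Definition basic_order (R : realType) (T : topologicalType)
    (le : T -> T -> Prop) : Prop :=
  [/\ partial_order le /\ (separable T /\ metrizable R T),
      exists2 join : T * T -> T,
        (forall x y, is_join le x y (join (x, y))) & continuous join,
      forall u : nat -> T,
        seq_bounded le u -> has_subseq (@seq_convergent T) u &
      forall u : nat -> T,
        seq_convergent u -> has_subseq (seq_bounded le) u].

Definition ideal_subset (I : set (set nat)) (a b : set_type I) : Prop :=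
  set_val a `<=` set_val b.

(* [Topological.axioms_ X] is the type of topological structures carried by
   [X]: packing one with [X] gives a [topologicalType] with carrier [X]. The
   eqType/choiceType components it also contains play no role. *)
Definition admits_basic_topology (R : realType) (I : set (set nat)) : Prop :=
  exists tau : Topological.axioms_ (set_type I),
    @basic_order R (@Topological.Pack (set_type I) tau) (@ideal_subset I).

(* Main.v *)
Require Import Defs.
From mathcomp Require Import all_boot all_order all_algebra.
From mathcomp Require Import all_classical all_reals all_analysis.

(** Write I = Fin phi and call lim_m phi (b \ m) the tail of b.

    If the tails of members of I are unbounded, choose b_n in I with tail at
    least n.  In a basic topology the bounded decreasing sequence (b_n \ m)_m
    clusters at the empty set, since lower cones are closed.  By metrizability a
    diagonal choice b_n \ m_n converges to the empty set, so it has a bounded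
    subsequence, whose bound has infinite submeasure: a contradiction.

    If all tails are below K, then every member of I is almost contained in
    A = {k : phi {k} < K}.  If A is in I, then A and the finite members of I
    generate I.  Otherwise arbitrarily late finite subsets of A have submeasure
    in [K, 2K), and flatness glues infinitely many of them into a member of I
    with tail at least K: a contradiction. *)

Set Implicit Arguments.
Unset Strict Implicit.

Import Order.TTheory GRing.Theory Num.Theory.
Local Open Scope classical_set_scope.
Local Open Scope ring_scope.

Lemma metrizable_hausdorff (R : realType) (T : topologicalType) :
  metrizable R T -> hausdorff_space T.
Proof.
move=> [d [d0 dE dC dT] dnbhs] x y xy; apply/dE/eqP; rewrite eq_le d0 andbT.
apply/ler_addgt0Pr => e e0; rewrite add0r.
have e20 : 0 < e / 2 by rewrite divr_gt0.
have [z [/= xz yz]] :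
    [set z | d x z < e / 2] `&` [set z | d y z < e / 2] !=set0.
  by apply: xy; apply/dnbhs; exists (e / 2).
apply: (le_trans (dT x z y)); rewrite (splitr e) lerD ?ltW//.
by rewrite dC.
Qed.

(** Lower cones are closed: being below [c] means [join (x, c) = c], an equation preserved in the
    limit because [join] is continuous and limits are unique. *)
Lemma basic_order_cvg_le (R : realType) (T : topologicalType)
    (le : T -> T -> Prop) (u : nat -> T) (l c : T) :
  basic_order R le -> u n @[n --> \oo] --> l ->
  (\forall n \near \oo, le (u n) c) -> le l c.
Proof.
move=> [[[lexx le_anti _] [_ /metrizable_hausdorff hT]] [join joinP joinC] _ _].
move=> ul uc; suff <- : join (l, c) = c by have [] := joinP l c.
have jl : join (u n, c) @[n --> \oo] --> join (l, c).
  apply: (@cvg_comp _ _ _ (fun n => (u n, c)) join _ (nbhs (l, c))).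
    by apply: cvg_pair => //; exact: cvg_cst.
  exact: joinC.
have jc : join (u n, c) @[n --> \oo] --> c.
  apply: cvg_near_cst; apply: filterS uc => n unc.
  have [_ cj jmin] := joinP (u n) c.
  by apply: le_anti => //; exact: jmin.
exact: (cvg_unique hT jl jc).
Qed.

Lemma homo_ltn_geid (s : nat -> nat) :
  {homo s : m n / (m < n)%N} -> forall n, (n <= s n)%N.
Proof.
by move=> sh; elim=> [//|n IH]; apply: (leq_ltn_trans IH); exact: sh.
Qed.

(** An ideal here may omit some singletons, so an initial segment must first be restricted to the
    points whose singleton belongs to [I]. *)
Lemma ideal_set1_initial (I : set (set nat)) (n : nat) : ideal I ->
  I ([set k | I [set k]] `&` `I_n).
Proof.
move=> [I0 Isub IU]; elim: n => [|n IH]; first by rewrite II0 setI0.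
have [In|nIn] := pselect (I [set n]).
  apply: Isub (IU _ _ IH In) => k [/= Ik]; rewrite ltnS leq_eqVlt.
  by move=> /orP[/eqP ->|kn]; [right|left].
apply: Isub IH => k [/= Ik]; rewrite ltnS leq_eqVlt => /orP[/eqP kn|//].
by rewrite kn in Ik.
Qed.

(** The generators are [A] enlarged by finite sets; downward closure puts the singleton of every
    point of a member in [I], so these finite sets catch what lies below [m]. *)
Lemma countably_generated_of_tails (I : set (set nat)) (A : set nat) :
  ideal I -> I A -> (forall b, I b -> exists m, b `\` `I_m `<=` A) ->
  countably_generated I.
Proof.
move=> Iid IA tails; have [_ Isub IU] := Iid.
pose g m := A `|` ([set k | I [set k]] `&` `I_m).
exists (range g); split.
- by move=> _ [m _ <-]; apply: IU => //; exact: ideal_set1_initial.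
- by apply: card_image_le.
- move=> b Ib; have [m bA] := tails b Ib; exists (g m); first by exists m.
  move=> k bk; have [km|km] := boolP (k < m)%N.
    by right; split=> //=; apply: Isub Ib => _ ->.
  by left; apply: bA; split=> //; exact/negP.
Qed.

Lemma unbounded_tails_no_basic_topology (R : realType) (I : set (set nat))
    (phi : set nat -> \bar R) :
  ideal I -> submeasure phi -> I = Fin phi ->
  (forall n : nat, exists2 b, I b &
     forall m, (n%:R%:E <= phi (b `\` `I_m))%E) ->
  ~ admits_basic_topology R I.
Proof.
move=> [I0 Isub _] [_ _ phi_le _] IE tails [tau].
set T := Topological.Pack tau => basic.
have mem (a : set nat) (Ia : I a) : exists t : T, set_val (t : set_type I) = a.
  by exists (SigSub (mem_set Ia) : set_type I).
have [t0 t0E] := mem _ I0.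
have [[_ [_ [d [d0 dE dC dT] dnbhs]]] _ bounded_cvg cvg_bounded] := basic.
have diag (n : nat) : exists t : T,
    d t0 t < n.+1%:R^-1 /\ (n%:R%:E <= phi (set_val (t : set_type I)))%E.
  have [b Ib bn] := tails n.
  have /choice[u uE] m : exists t : T, set_val (t : set_type I) = b `\` `I_m.
    by apply: mem; apply: Isub Ib => k [].
  have [tb tbE] := mem _ Ib.
  have [|s sh [l ul]] := bounded_cvg u.
    by exists tb => m; rewrite /ideal_subset uE tbE => k [].
  (* A point [k] of [l] is impossible: from index [k.+1] on, [u \o s] stays below [u k.+1], hence so
     does [l], yet [u k.+1] omits [k]. *)
  have lE : l = t0.
    have [[[_ le_anti _] _] _ _ _] := basic.
    apply: le_anti; last by rewrite /ideal_subset t0E.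
    rewrite /ideal_subset t0E => k lk.
    suff : ideal_subset l (u k.+1).
      by move=> /(_ k lk); rewrite uE => -[_ /=]; rewrite ltnSn.
    apply: (basic_order_cvg_le basic ul); exists k.+1 => //= m /= km.
    rewrite /ideal_subset !uE => i [bi /= im]; split=> //= ik; apply: im.
    by rewrite (leq_trans ik)// (leq_trans km)// homo_ltn_geid.
  rewrite lE in ul.
  have /ul[M _ sM] : nbhs t0 [set y | d t0 y < n.+1%:R^-1].
    by apply/dnbhs; exists n.+1%:R^-1; rewrite ?invr_gt0 ?ltr0n.
  exists (u (s M)); split; last by rewrite uE.
  exact: (sM M (leqnn M)).
have /choice[v vP] := diag.
(* The first bound in [vP] makes [v] converge to [t0]; the second makes any bound [c] of a
   subsequence have infinite submeasure. *)
have [|s sh [c vc]] := cvg_bounded v.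
  exists t0 => A /dnbhs[e e0 eA].
  have := near_infty_natSinv_lt (PosNum e0); move=> [M _ Me].
  by exists M => // n Mn; apply: eA; apply: (lt_trans (vP n).1); exact: Me.
have : I (set_val (c : set_type I)).
  by apply: set_mem; exact: (valP (c : set_type I)).
have cn (n : nat) : (n%:R%:E <= phi (set_val (c : set_type I)))%E.
  apply: le_trans (phi_le _ _ (vc n)); apply: le_trans (vP (s n)).2.
  by rewrite lee_fin ler_nat homo_ltn_geid.
rewrite {1}IE /Fin /=; case: (phi _) cn => [r|//|/(_ 0%N)//] rn _.
have := rn (Num.truncn `|r|).+1; rewrite lee_fin leNgt => /negP; apply.
apply: (le_lt_trans (ler_norm r)).
by rewrite truncnS_gt.
Qed.

(** Initial segments of [C] reach [K] by lower semicontinuity. The first one to do so exceeds a set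
    of submeasure below [K] by at most one point, which adds less than [K]. *)
Lemma lsc_finite_subset_between (R : realType) (phi : set nat -> \bar R)
    (K : R) (C : set nat) :
  submeasure phi -> lsc phi -> phi C = +oo%E ->
  (forall k, C k -> (phi [set k] < K%:E)%E) ->
  exists e, [/\ finite_set e, e `<=` C, (K%:E <= phi e)%E &
                (phi e < (K + K)%:E)%E].
Proof.
move=> [phi_ge0 phi0 phi_le phiU] phi_lsc Coo CK.
pose c n := C `&` [set k | (k <= n)%N].
have cfin n : finite_set (c n).
  apply: (sub_finite_set _ (finite_II n.+1)) => k [_ /=].
  by rewrite ltnS.
have K0 : 0 < K.
  have [k Ck] : C !=set0.
    by apply/set0P/eqP => C0; move: Coo; rewrite C0 phi0.
  by rewrite -lte_fin; apply: le_lt_trans (CK k Ck).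
have [n0 Kn0] : exists n, (K%:E <= phi (c n))%E.
  have := phi_lsc C; rewrite Coo => /cvgeyPge/(_ K)[n0 _ Kn0].
  by exists n0; exact: (Kn0 n0 (leqnn n0)).
have [n Kn nmin] := ex_minnP (ex_intro (fun n => K%:E <= phi (c n))%E n0 Kn0).
exists (c n); split => //; first by move=> k [].
have cn_lt : (phi (C `&` `I_n) < K%:E)%E.
  case: n nmin {Kn} => [_|n nmin]; first by rewrite II0 setI0 phi0 lte_fin.
  rewrite ltNge; apply/negP => /nmin; by rewrite ltnn.
have cn1_lt : (phi (C `&` [set n]) < K%:E)%E.
  have [Cn|nCn] := pselect (C n).
    by apply: le_lt_trans (CK n Cn); apply: phi_le => k [].
  apply: (@le_lt_trans _ _ (phi set0)); last by rewrite phi0 lte_fin.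
  by apply: phi_le => k [Ck /= kn]; apply: nCn; rewrite -kn.
apply: (@le_lt_trans _ _ (phi ((C `&` `I_n) `|` (C `&` [set n])))).
  apply: phi_le => k [Ck /=]; rewrite leq_eqVlt => /orP[/eqP kn|kn].
    by right; split.
  by left.
by apply: le_lt_trans (phiU _ _) _; rewrite EFinD; exact: lteD.
Qed.

(** Each truncation of the union is finite, so it already lies in some [a m]; the bound then passes
    to the limit. *)
Lemma lsc_bigcup_le (R : realType) (phi : set nat -> \bar R) (N : \bar R)
    (a : nat -> set nat) :
  submeasure phi -> lsc phi -> {homo a : m n / (m <= n)%N >-> m `<=` n} ->
  (forall n, (phi (a n) <= N)%E) -> (phi (\bigcup_n a n) <= N)%E.
Proof.
move=> [_ _ phi_le _] phi_lsc a_homo aN.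
have trunc n : exists m, (\bigcup_n a n) `&` [set k | (k <= n)%N] `<=` a m.
  elim: n => [|n [m Hm]].
    have [[m _ am]|na] := pselect ((\bigcup_n a n) 0%N).
      by exists m => k [_ /=]; rewrite leqn0 => /eqP ->.
    by exists 0%N => k [ak /=]; rewrite leqn0 => /eqP k0; rewrite k0 in ak.
  have [[m' _ am]|na] := pselect ((\bigcup_n a n) n.+1).
    exists (maxn m m') => k [ak /=]; rewrite leq_eqVlt => /orP[/eqP ->|kn].
      by apply: a_homo am; rewrite leq_maxr.
    by apply: (a_homo m); [rewrite leq_maxl|exact: Hm].
  exists m => k [ak /=]; rewrite leq_eqVlt => /orP[/eqP kn|kn].
    by rewrite kn in ak.
  exact: Hm.
have /cvg_lim <- // := phi_lsc (\bigcup_n a n).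
apply: lime_le; first by apply/cvg_ex; eexists; exact: phi_lsc.
by apply: nearW => n; have [m /phi_le/le_trans] := trunc n; apply.
Qed.

Lemma flat_large_tail (R : realType) (phi : set nat -> \bar R) (K : R) :
  submeasure phi -> lsc phi -> flat phi -> 0 < K ->
  (forall j, phi ([set k | (phi [set k] < K%:E)%E] `\` `I_j) = +oo%E) ->
  exists2 b, Fin phi b & forall m, (K%:E <= phi (b `\` `I_m))%E.
Proof.
move=> phi_sub phi_lsc phi_flat K0 Aoo.
have [phi_ge0 phi0 phi_le phiU] := phi_sub.
have [N N0 NP] := phi_flat (K + K) (addr_gt0 K0 K0).
pose good a := finite_set a /\ (phi a < N%:E)%E.
(* A pair is the current set and the stage. Placing [good] under the existential makes [f] total,
   with [set0] as default value. *)
have /choice[f fP] (p : set nat * nat) : exists a', good p.1 ->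
    [/\ good a', p.1 `<=` a' & (K%:E <= phi (a' `\` `I_p.2))%E].
  case: p => a n /=; have [[afin aN]|] := pselect (good a); last by exists set0.
  (* The new piece starts beyond [j] so that flatness keeps the union below [N], and beyond [n] so
     that it survives the removal of [I_n]. *)
  have [j jP] := NP a afin aN.
  have [|e [efin eA Ke e2K]] :=
    lsc_finite_subset_between (K := K) phi_sub phi_lsc (Aoo (maxn j n)).
    by move=> k [].
  exists (a `|` e) => _; split => //.
  - split; first by rewrite finite_setU.
    apply: jP => // k /eA[_ /= km] kj; apply: km.
    by rewrite (leq_trans kj)// leq_maxl.
  - apply: (le_trans Ke); apply: phi_le => k ek; split; first by right.
    have [_ /= km] := eA k ek => kn; apply: km.
    by rewrite (leq_trans kn)// leq_maxr.
pose a := fix a n := if n is m.+1 then f (a m, m) else set0.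
have agood n : good (a n).
  elim: n => [|n IH]; first by split; rewrite /= ?phi0 ?lte_fin.
  by have [] := fP (a n, n) IH.
have aS n : a n `<=` a n.+1 by have [] := fP (a n, n) (agood n).
exists (\bigcup_n a n).
  apply: (@le_lt_trans _ _ N%:E); last exact: ltry.
  apply: lsc_bigcup_le => //; last by move=> n; apply: ltW; case: (agood n).
  by apply: homo_leq => // [x|y x z]; [exact: subset_refl|exact: subset_trans].
move=> m; have [_ _ Km] := fP (a m, m) (agood m); apply: (le_trans Km).
by apply: phi_le => k [ak km]; split=> //; exists m.+1.
Qed.

Theorem theorem3p1 (R : realType) (I : set (set nat)) (hI : flat_ideal R I) :
  countably_generated I \/ ~ admits_basic_topology R I.
Proof.
have [Iid [phi [phi_sub phi_lsc phi_flat IE]]] := hI.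
have [phi_ge0 phi0 phi_le phiU] := phi_sub.
have [cg|ncg] := pselect (countably_generated I); [by left|right].
apply: (unbounded_tails_no_basic_topology Iid phi_sub IE) => n.
(* The successor keeps [K] positive when [n] is 0. *)
pose K : R := n.+1%:R; pose A := [set k | (phi [set k] < K%:E)%E].
have [all_small|] :=
  pselect (forall b, I b -> exists m, (phi (b `\` `I_m) < K%:E)%E).
  exfalso; apply: ncg.
  have tailA b : I b -> exists m, b `\` `I_m `<=` A.
    move=> /all_small[m bm]; exists m => k bk; apply: le_lt_trans bm.
    by apply: phi_le => _ ->.
  apply: (countably_generated_of_tails Iid _ tailA).
  apply: contrapT => nIA.
  have [||b Ib Kb] := flat_large_tail (K := K) phi_sub phi_lsc phi_flat.
  - by rewrite ltr0n.
  (* If a tail of [A] had finite submeasure, adding back the finitely many points of [A] below [j],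
     whose singletons are in [I], would put [A] in [I]. *)
  - move=> j; apply/eqP; rewrite -leye_eq leNgt; apply/negP => Aj; apply: nIA.
    have [_ Isub IU] := Iid.
    have IAj : I (A `\` `I_j) by rewrite IE.
    apply: Isub (IU _ _ IAj (ideal_set1_initial j Iid)) => k Ak.
    have [kj|kj] := boolP (k < j)%N; last by left; split=> //; exact/negP.
    by right; split=> //=; rewrite IE; exact: (lt_trans Ak (ltry _)).
  - by have [m] := all_small b ltac:(by rewrite IE); rewrite ltNge Kb.
move=> /existsNP[b /not_implyP[Ib /forallNP bK]]; exists b => // m.
apply: (@le_trans _ _ K%:E); first by rewrite lee_fin ler_nat.
by rewrite leNgt; apply/negP; exact: bK.
Qed.
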